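(* Given any partial ascending permutation $\delta\in\Delta$, the coefficients $\{\eta^{\delta}_{\delta_j}\}_{j\in[n]}$ of the lifted extended polymatroid inequality $w\ge\sum_{i=1}^n\eta^\delta_{\delta_i}x_{\delta_i}$ defined by $\delta$ can be computed in $O(n)$ time.
   Context: For a non-negative integer $m$, $[m]=\{1,\dots,m\}$ with $[0]=\varnothing$. Let $n,t$ be positive integers, $f:\mathbb{R}\to\mathbb{R}$ a concave function with $f(0)=0$, $a\in\mathbb{R}^n$ with non-negative entries, and $\{N_k\}_{k\in[t]}$ a partition of $[n]$ into consecutive blocks: with $i_0:=0$ and $i_k:=\sum_{j=1}^k|N_j|$, $N_k=\{i_{k-1}+1,\dots,i_k\}$. Within each block the entries of $a$ are ascending: $a_{i_{k-1}+1}\le\cdots\le a_{i_k}$ for all $k\in[t]$. For $S\subseteq[n]$, $a(S):=\sum_{i\in S}a_i$. For a permutation $\delta$ of $[n]$, let $\delta(j):=\{\delta_1,\dots,\delta_j\}$ and $\delta(0)=\varnothing$. The lifting coefficients are defined recursively for $j=1,\dots,n$ by $$\eta^{\delta}_{\delta_j}:=\min_{S}\Big\{ f(a(S))-\sum_{i\in S\setminus\{\delta_j\}}\eta^{\delta}_i \;:\; S\subseteq\delta(j),\ |S\cap N_k|\le 1\ \ \forall k\in[t],\ \delta_j\in S\Big\}.$$ A permutation $\delta$ of $[n]$ is called partial ascending if for all $i,j\in[n]$ and $k\in[t]$ with $i<j$ and $\delta_i,\delta_j\in N_k$, one has $\delta_i<\delta_j$. $\Delta$ denotes the set of all partial ascending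 permutations of $[n]$. Time is counted as the number of elementary operations (real arithmetic, comparisons, and evaluations of $f$ at a point, each at unit cost). *)

(* Defs.v *)
From HB Require Import structures.
From mathcomp Require Import all_boot all_order all_fingroup all_algebra.
From mathcomp Require Import reals.

Set Implicit Arguments.
Unset Strict Implicit.
Unset Printing Implicit Defensive.
Import Order.TTheory GRing.Theory Num.Theory.
Local Open Scope ring_scope.

(* All indices start at 0: [n] is 'I_n, [t] is 'I_t, and delta_j is delta j. *)

Definition concave (R : realType) (f : R -> R) : Prop :=
  forall (x y l : R), 0 <= l -> l <= 1 ->
    l * f x + (1 - l) * f y <= f (l * x + (1 - l) * y).

Section Blocks.
Variables (n t : nat) (N : 'I_t -> {set 'I_n}).

Definition block_start (m : nat) : nat := (\sum_(k < t | k < m) #|N k|)%N.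

(* [partition] makes every block nonempty. *)
Definition consecutive_partition : Prop :=
  partition [set N k | k : 'I_t] [set: 'I_n] /\
  forall k : 'I_t,
    N k = [set i : 'I_n | (block_start k <= i < block_start k.+1)%N].

Definition block_ascending (R : realType) (a : 'I_n -> R) : Prop :=
  forall k : 'I_t, {in N k &, forall i j : 'I_n, (i <= j)%N -> a i <= a j}.

Definition partial_ascending (delta : {perm 'I_n}) : Prop :=
  forall (i j : 'I_n) (k : 'I_t),
    (i < j)%N -> delta i \in N k -> delta j \in N k -> (delta i < delta j)%N.

End Blocks.

Section LiftingCoefficients.
Variables (R : realType) (n t : nat) (f : R -> R) (a : 'I_n -> R).
Variables (N : 'I_t -> {set 'I_n}) (delta : {perm 'I_n}).

Definition prefix_set (j : 'I_n) : {set 'I_n} :=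
  [set delta l | l : 'I_n & (l <= j)%N].

Definition feasible (j : 'I_n) (S : {set 'I_n}) : bool :=
  [&& S \subset prefix_set j, [forall k, #|S :&: N k| <= 1]%N & delta j \in S].

Definition objective (e : 'I_n -> R) (j : 'I_n) (S : {set 'I_n}) : R :=
  f (\sum_(i in S) a i) - \sum_(i in S :\ delta j) e i.

(* The default value of the iterated minimum is the objective at the singleton
   {delta_j}, so that it equals the minimum as soon as this set is feasible. *)
Definition min_objective (e : 'I_n -> R) (j : 'I_n) : R :=
  \big[Num.min/objective e j [set delta j]]_(S : {set 'I_n} | feasible j S)
    objective e j S.

(* [lift_upto m] holds the coefficients of the first m elements delta_0, ...,
   delta_(m-1), and 0 for the elements that are not yet lifted. *)
Fixpoint lift_upto (m : nat) (i : 'I_n) : R :=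
  if m is m'.+1 then
    let j := (delta^-1)%g i in
    if j == m' :> nat then min_objective (lift_upto m') j else lift_upto m' i
  else 0.

Definition lift_coef : 'I_n -> R := lift_upto n.

Lemma lift_uptoE (m : nat) (j : 'I_n) :
  (j < m)%N -> lift_upto m (delta j) = min_objective (lift_upto j) j.
Proof.
elim: m => // m IHm; rewrite ltnS leq_eqVlt /= permK.
by case: eqVneq => [<- //|_] /= /IHm.
Qed.

Lemma lift_coefE (j : 'I_n) : lift_coef (delta j) = min_objective lift_coef j.
Proof.
have eq_obj (S : {set 'I_n}) : S \subset prefix_set j ->
  objective (lift_upto j) j S = objective lift_coef j S.
  move=> sSj; congr (_ - _); apply: eq_bigr => i /setD1P[ne_ij iS].
  have /imsetP[l] := subsetP sSj _ iS; rewrite inE => le_lj def_i.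
  have lt_lj : (l < j)%N.
    rewrite ltn_neqAle le_lj andbT; apply: contraNneq ne_ij => eq_lj.
    by rewrite def_i (inj_eq perm_inj); apply/eqP/val_inj.
  by rewrite def_i /lift_coef !lift_uptoE.
rewrite /lift_coef lift_uptoE // /min_objective.
rewrite eq_obj; last first.
  by rewrite sub1set; apply/imsetP; exists j; rewrite ?inE.
by apply: eq_bigr => S /and3P[sSj _ _]; apply: eq_obj.
Qed.

Lemma lift_coef_min (j : 'I_n) :
  (exists2 S : {set 'I_n},
     feasible j S & lift_coef (delta j) = objective lift_coef j S) /\
  (forall S : {set 'I_n},
     feasible j S -> lift_coef (delta j) <= objective lift_coef j S).
Proof.
rewrite lift_coefE; split; last first.
  by move=> S Sj; rewrite /min_objective (bigD1 S) //= ge_min lexx.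
have feas1 : feasible j [set delta j].
  apply/and3P; split; last exact: set11.
    by rewrite sub1set; apply/imsetP; exists j; rewrite ?inE.
  apply/forallP=> k.
  by rewrite (leq_trans (subset_leq_card (subsetIl _ _))) ?cards1.
rewrite /min_objective.
pose K x := exists2 S, feasible j S & x = objective lift_coef j S.
apply: (big_ind K); first by exists [set delta j].
  by move=> x y Kx Ky; rewrite /Order.min; case: ifP.
by move=> S Sj; exists S.
Qed.

End LiftingCoefficients.

(* Real random-access programs. The memory consists of arrays of indices and
   arrays of reals, all addressed by natural numbers. A scalar variable is a
   cell at a constant position of an array. *)
Inductive iexp : Type :=
  | IConst of nat
  | IGet of nat & iexp              (* array, position *)
  | IAdd of iexp & iexp
  | ISub of iexp & iexp.            (* truncated *)

Inductive rexp : Type :=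
  | RConst of nat
  | RGet of nat & iexp              (* array, position *)
  | RAdd of rexp & rexp
  | RSub of rexp & rexp
  | RMul of rexp & rexp
  | RDiv of rexp & rexp
  | REval of rexp.                  (* value of f at a point *)

Inductive test : Type :=
  | ILe of iexp & iexp
  | RLe of rexp & rexp.

Inductive cmd : Type :=
  | ISet of nat & iexp & iexp       (* array, position, new value *)
  | RSet of nat & iexp & rexp       (* array, position, new value *)
  | Seq of cmd & cmd
  | If of test & cmd & cmd
  | While of test & cmd.

Record state (R : Type) : Type := State {
  imem : nat -> nat -> nat;
  rmem : nat -> nat -> R
}.

Definition update (T : Type) (mem : nat -> nat -> T) (x p : nat) (v : T) :
    nat -> nat -> T :=
  fun y q => if (y == x) && (q == p) then v else mem y q.

(* Every constant, memory access, arithmetic operation, comparison, evaluation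
   of f and assignment costs 1, for indices as well as for reals. *)
Fixpoint icost (e : iexp) : nat :=
  match e with
  | IConst _ => 1
  | IGet _ p => (icost p).+1
  | IAdd e1 e2 | ISub e1 e2 => (icost e1 + icost e2).+1%N
  end.

Fixpoint rcost (e : rexp) : nat :=
  match e with
  | RConst _ => 1
  | RGet _ p => (icost p).+1
  | RAdd e1 e2 | RSub e1 e2 | RMul e1 e2 | RDiv e1 e2 =>
      (rcost e1 + rcost e2).+1%N
  | REval e1 => (rcost e1).+1
  end.

Definition tcost (b : test) : nat :=
  match b with
  | ILe e1 e2 => (icost e1 + icost e2).+1%N
  | RLe e1 e2 => (rcost e1 + rcost e2).+1%N
  end.

Section Semantics.
Variables (R : realType) (f : R -> R).

Fixpoint ieval (s : state R) (e : iexp) : nat :=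
  match e with
  | IConst c => c
  | IGet x p => imem s x (ieval s p)
  | IAdd e1 e2 => (ieval s e1 + ieval s e2)%N
  | ISub e1 e2 => (ieval s e1 - ieval s e2)%N
  end.

Fixpoint reval (s : state R) (e : rexp) : R :=
  match e with
  | RConst c => c%:R
  | RGet x p => rmem s x (ieval s p)
  | RAdd e1 e2 => reval s e1 + reval s e2
  | RSub e1 e2 => reval s e1 - reval s e2
  | RMul e1 e2 => reval s e1 * reval s e2
  | RDiv e1 e2 => reval s e1 / reval s e2
  | REval e1 => f (reval s e1)
  end.

Definition teval (s : state R) (b : test) : bool :=
  match b with
  | ILe e1 e2 => (ieval s e1 <= ieval s e2)%N
  | RLe e1 e2 => reval s e1 <= reval s e2
  end.

(* [exec c s T s'] : started in s, the program c halts in s' after T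
   elementary operations. *)
Inductive exec : cmd -> state R -> nat -> state R -> Prop :=
  | ExecISet x p e s :
      exec (ISet x p e) s (icost p + icost e).+1%N
        (State (update (imem s) x (ieval s p) (ieval s e)) (rmem s))
  | ExecRSet x p e s :
      exec (RSet x p e) s (icost p + rcost e).+1%N
        (State (imem s) (update (rmem s) x (ieval s p) (reval s e)))
  | ExecSeq c1 c2 s1 s2 s3 T1 T2 :
      exec c1 s1 T1 s2 -> exec c2 s2 T2 s3 -> exec (Seq c1 c2) s1 (T1 + T2)%N s3
  | ExecIf b c1 c2 s s' T :
      exec (if teval s b then c1 else c2) s T s' ->
      exec (If b c1 c2) s (tcost b + T)%N s'
  | ExecWhileDone b c s :
      ~~ teval s b -> exec (While b c) s (tcost b) s
  | ExecWhileStep b c s1 s2 s3 T1 T2 :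
      teval s1 b -> exec c s1 T1 s2 -> exec (While b c) s2 T2 s3 ->
      exec (While b c) s1 (tcost b + T1 + T2)%N s3.

Lemma exec_det (c : cmd) (s s1 s2 : state R) (T1 T2 : nat) :
  exec c s T1 s1 -> exec c s T2 s2 -> T1 = T2 /\ s1 = s2.
Proof.
move=> run1; elim: run1 T2 s2 => {c s s1 T1}.
- by move=> x p e s T2 s2 run2; inversion run2.
- by move=> x p e s T2 s2 run2; inversion run2.
- move=> c1 c2 s1 s2 s3 T1 T2 _ IH1 _ IH2 T s run2.
  inversion run2 as [| |? ? ? s2' ? T1' T2' r1 r2| | |]; subst.
  by have [? ?] := IH1 _ _ r1; subst; have [? ?] := IH2 _ _ r2; subst.
- move=> b c1 c2 s s' T _ IH T2 s2 run2.
  by inversion run2 as [| | |? ? ? ? ? ? r| |]; subst; have [-> ->] := IH _ _ r.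
- move=> b c s nb T2 s2 run2; inversion run2 => //; subst.
  by case/negP: nb.
- move=> b c s1 s2 s3 T1 T2 tb _ IH1 _ IH2 T s run2.
  inversion run2 as [| | | |? ? ? nb|? ? ? s2' ? T1' T2' tb' r1 r2]; subst.
    by case/negP: nb.
  by have [? ?] := IH1 _ _ r1; subst; have [? ?] := IH2 _ _ r2; subst.
Qed.

End Semantics.

(* Index array 0 holds n and t, index array 1 the block sizes |N_k|, index
   array 2 the permutation, and real array 0 the vector a. The other memory
   cells are arbitrary. *)
Definition encodes_input (R : realType) (n t : nat) (a : 'I_n -> R)
    (N : 'I_t -> {set 'I_n}) (delta : {perm 'I_n}) (s : state R) : Prop :=
  [/\ imem s 0 0 = n /\ imem s 0 1 = t,
      forall k : 'I_t, imem s 1 k = #|N k|,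
      forall j : 'I_n, imem s 2 j = delta j
    & forall i : 'I_n, rmem s 0 i = a i].

(* The coefficient of the element i is expected in cell i of real array 1. *)
Definition encodes_output (R : realType) (n : nat) (e : 'I_n -> R)
    (s : state R) : Prop :=
  forall i : 'I_n, rmem s 1 i = e i.

(* Main.v *)
Require Import Defs.
From HB Require Import structures.
From mathcomp Require Import all_boot all_order all_fingroup all_algebra.
From mathcomp Require Import reals.
From mathcomp Require Import zify ring lra.

Set Implicit Arguments.
Unset Strict Implicit.
Unset Printing Implicit Defensive.
Import Order.TTheory GRing.Theory Num.Theory.
Local Open Scope ring_scope.

(** A partial ascending permutation lifts each block in increasing order, so the
   best set S for delta_j consists of the latest lifted element of every block.
   With d_i the increment of a over the block predecessor of i and s_m the sum
   of d over the first m lifted elements, this gives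
     eta(delta_j) = f(s_(j+1)) - f(s_j) + eta(block predecessor of delta_j),
   which is evaluated in constant time. Optimality: the coefficients of a set S
   with at most one element in each block sum up to the increments of f along
   the elements lying below S in their blocks, and by concavity these are at
   most the increments of f along the partial sums of d over these elements
   alone, which telescope to f(a(S)). *)

(** * Increments of a concave function along partial sums *)

(** With [z = y + d], the points [x + d] and [y] are convex combinations of [x] and [z] with swapped
    weights, so the two concavity inequalities add up to [f x + f z <= f (x + d) + f y]. *)
Lemma concave_increment (R : realType) (f : R -> R) (x y d : R) :
  concave f -> x <= y -> 0 <= d -> f (y + d) - f y <= f (x + d) - f x.
Proof.
move=> f_cv le_xy d_ge0.
(* This case is split off so that [z - x] below is a nonzero denominator even when [d = 0]. *)
have [eq_xy|ne_xy] := eqVneq x y; first by rewrite eq_xy.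
have lt_xy : x < y by rewrite lt_neqAle ne_xy.
pose z := y + d; pose l := (y - x) / (z - x).
have zx_gt0 : 0 < z - x by rewrite /z; lra.
have zx_neq0 : z - x != 0 by rewrite gt_eqF.
have l_ge0 : 0 <= l by rewrite divr_ge0 //; lra.
have l_le1 : l <= 1 by rewrite /l ler_pdivrMr // /z; lra.
have lE : l * (z - x) = y - x by rewrite /l divfK.
have f1 := f_cv x z l l_ge0 l_le1.
have f2 := f_cv z x l l_ge0 l_le1.
have e1 : l * x + (1 - l) * z = x + d by move: lE; rewrite /z => lE; nra.
have e2 : l * z + (1 - l) * x = y by nra.
rewrite e1 in f1; rewrite e2 in f2; rewrite -/z; nra.
Qed.

Lemma sum_ord_ltnS (R : nmodType) (n : nat) (D : pred 'I_n) (F : 'I_n -> R)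
    (m : 'I_n) :
  \sum_(l : 'I_n | (l < m.+1)%N && D l) F l =
  (if D m then F m else 0) +
  \sum_(l : 'I_n | (l < m)%N && D l) F l.
Proof.
case: ifP => Dm; last first.
  rewrite add0r; apply: eq_bigl => l; rewrite ltnS leq_eqVlt.
  by case: eqVneq => //= /val_inj ->; rewrite Dm ltnn.
rewrite (bigD1 m) /=; last by rewrite ltnSn.
congr (_ + _); apply: eq_bigl => l.
by case: (D l); rewrite ?andbF // !andbT ltnS andbC (ltn_neqAle (l : nat)).
Qed.

Section PartialSums.
Variables (R : realType) (n : nat) (f : R -> R) (d : 'I_n -> R).

Definition partial_sum (m : nat) : R := \sum_(l : 'I_n | (l < m)%N) d l.

Lemma partial_sum0 : partial_sum 0 = 0.
Proof. by rewrite /partial_sum big1. Qed.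

Lemma partial_sumS (m : 'I_n) : partial_sum m.+1 = partial_sum m + d m.
Proof.
have := sum_ord_ltnS predT d m; rewrite /partial_sum /= addrC.
by under eq_bigl do rewrite andbT; under [in RHS]eq_bigl do rewrite andbT.
Qed.

Lemma sum_increments (m : nat) : f 0 = 0 -> (m <= n)%N ->
  \sum_(l : 'I_n | (l < m)%N) (f (partial_sum l.+1) - f (partial_sum l)) =
  f (partial_sum m).
Proof.
move=> f0; elim: m => [|m IHm] lt_mn; first by rewrite partial_sum0 f0 big1.
have := sum_ord_ltnS predT
  (fun l : 'I_n => f (partial_sum l.+1) - f (partial_sum l)) (Ordinal lt_mn).
under eq_bigl do rewrite andbT; under [X in _ = _ + X]eq_bigl do rewrite andbT.
by move=> ->; rewrite /= IHm ?subrK // ltnW.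
Qed.

(* Increments of a concave function at points with smaller abscissa are larger,
   and the partial sums over D never exceed those over all indices. *)
Lemma sum_increments_le (D : pred 'I_n) :
  concave f -> f 0 = 0 -> (forall l, 0 <= d l) ->
  \sum_(l | D l) (f (partial_sum l.+1) - f (partial_sum l)) <=
  f (\sum_(l | D l) d l).
Proof.
move=> f_cv f0 d_ge0.
have step m : (m <= n)%N ->
  \sum_(l : 'I_n | (l < m)%N && D l) (f (partial_sum l.+1) - f (partial_sum l))
  <= f (\sum_(l : 'I_n | (l < m)%N && D l) d l).
  elim: m => [|m IHm] lt_mn; first by rewrite !big1 ?f0.
  rewrite !(sum_ord_ltnS _ _ (Ordinal lt_mn)) /=.
  have := IHm (ltnW lt_mn).
  case: ifP => Dm; last by rewrite !add0r.
  rewrite (partial_sumS (Ordinal lt_mn)) /=.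
  set x := \sum_(_ | _) d _ => IH.
  have le_x : x <= partial_sum m.
    rewrite /x /partial_sum big_mkcondr; apply: ler_sum => l _.
    by case: ifP.
  have := concave_increment f_cv le_x (d_ge0 (Ordinal lt_mn)).
  by rewrite [d _ + x]addrC; move: IH; lra.
have := step n (leqnn n).
by under eq_bigl do rewrite ltn_ord; under [X in f X]eq_bigl do rewrite ltn_ord.
Qed.

End PartialSums.

(** * Consecutive blocks, block predecessors and telescoping inside blocks *)

Section BlockStructure.
Variables (n t : nat) (N : 'I_t -> {set 'I_n}).
Hypothesis N_part : consecutive_partition N.

Lemma block_startS (k : 'I_t) :
  block_start N k.+1 = (block_start N k + #|N k|)%N.
Proof.
rewrite /block_start (bigD1 k) //= addnC; congr (_ + _)%N.
apply: eq_bigl => l; rewrite ltnS andbC.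
by rewrite (ltn_neqAle (l : nat)).
Qed.

Lemma block_start0 : block_start N 0 = 0%N.
Proof. by rewrite /block_start big1. Qed.

Lemma leq_block_start (m m' : nat) :
  (m <= m')%N -> (block_start N m <= block_start N m')%N.
Proof.
move=> le_m; rewrite /block_start [leqLHS]big_mkcond [leqRHS]big_mkcond /=.
apply: leq_sum => k _; case: ifP => // lt_km.
by rewrite (leq_trans lt_km le_m).
Qed.

Lemma card_block_gt0 (k : 'I_t) : (0 < #|N k|)%N.
Proof.
have [/and3P[_ _ N0] _] := N_part.
by rewrite card_gt0; apply: contraNneq N0 => <-; apply: imset_f.
Qed.

Lemma leq_block_start_id (m : nat) : (m <= t)%N -> (m <= block_start N m)%N.
Proof.
elim: m => // m IHm lt_mt.
rewrite (block_startS (Ordinal lt_mt)) -addn1.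
by apply: leq_add; [apply: IHm; apply: ltnW | apply: card_block_gt0].
Qed.

Lemma block_start_lt (k : 'I_t) : (block_start N k < n)%N.
Proof.
have /card_gt0P[i] := card_block_gt0 k.
have [_ ->] := N_part; rewrite inE => /andP[le_i _].
exact: leq_ltn_trans (ltn_ord i).
Qed.

(** Blocks are nonempty, so the last one starts at position at least [t - 1], and this position is
    below [n]. The bound absorbs the time spent scanning the blocks into O(n). *)
Lemma num_blocks_leq : (t <= n)%N.
Proof.
have [->//|t_gt0] := posnP t.
have lt_t : (t.-1 < t)%N by rewrite prednK.
have := block_start_lt (Ordinal lt_t) => /=.
by have := leq_block_start_id (ltnW lt_t); lia.
Qed.

Lemma block_index : exists b : 'I_n -> 'I_t, forall i k, (i \in N k) = (b i == k).
Proof.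
have [/and3P[/eqP N_cov _ _] NE] := N_part.
have [b bP] : exists b : 'I_n -> 'I_t, forall i, i \in N (b i).
  apply: (@fin_all_exists _ (fun=> 'I_t) (fun i k => i \in N k)) => i; have := in_setT i.
  by rewrite -N_cov => /bigcupP[_ /imsetP[k _ ->]]; exists k.
(* The partition is a set of blocks and does not separate indices of equal blocks; uniqueness of the
   index comes from the interval form. *)
exists b => i k; apply/idP/eqP => [|<-//].
have := bP i; rewrite (NE k) (NE (b i)) !inE => ib ik; apply: val_inj.
have [lt_bk|lt_kb|//] := ltngtP (b i) k.
  by have := leq_block_start lt_bk; lia.
by have := leq_block_start lt_kb; lia.
Qed.

Definition is_block_start (i : nat) : bool := [exists k : 'I_t, i == block_start N k].

Lemma block_start_first (b : 'I_n -> 'I_t) (i i' : 'I_n) :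
  (forall i k, (i \in N k) = (b i == k)) ->
  is_block_start i -> b i' = b i -> (i <= i')%N.
Proof.
move=> bP /existsP[k /eqP i_k] b_i'.
have iNk : i \in N k.
  have [_ ->] := N_part; rewrite inE block_startS -i_k leqnn /=.
  by rewrite -[ltnLHS]addn0 ltn_add2l card_block_gt0.
have : i' \in N k by rewrite bP b_i' -bP.
by have [_ ->] := N_part; rewrite inE i_k => /andP[].
Qed.

(** [ord_pred] reduces modulo [n], hence the restriction to positive [i]. *)
Lemma ord_pred_val (i : 'I_n) : (0 < i)%N -> ord_pred i = i.-1 :> nat.
Proof.
move=> i_gt0; rewrite /= -(prednK i_gt0) addSn /= modnDr modn_small //.
by have := ltn_ord i; lia.
Qed.

Lemma not_block_start (b : 'I_n -> 'I_t) (i : 'I_n) :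
  (forall i k, (i \in N k) = (b i == k)) ->
  ~~ is_block_start i -> (0 < i)%N /\ b (ord_pred i) = b i.
Proof.
move=> bP /existsPn /(_ (b i)) ne_i.
have : i \in N (b i) by rewrite bP.
have [_ NE] := N_part; rewrite NE inE => /andP[le_i lt_i].
have i_gt0 : (0 < i)%N by lia.
split=> //; apply/eqP; rewrite -bP NE inE ord_pred_val //; lia.
Qed.


Variable b : 'I_n -> 'I_t.
Hypothesis bP : forall i k, (i \in N k) = (b i == k).

(** The value 0 at a block start plays the role of an empty predecessor. The function [h] is a
    parameter because the same convention serves the weights, the coefficients and the sums over
    [block_lower]. *)
Definition block_pred (V : nmodType) (h : 'I_n -> V) (i : 'I_n) : V :=
  if is_block_start i then 0 else h (ord_pred i).

Definition block_lower (i : 'I_n) : {set 'I_n} :=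
  [set i' : 'I_n | (i' <= i)%N & b i' == b i].

Lemma sum_block_lower (V : nmodType) (h : 'I_n -> V) (i : 'I_n) :
  \sum_(i' in block_lower i) h i' =
  h i + block_pred (fun p => \sum_(i' in block_lower p) h i') i.
Proof.
rewrite (bigD1 i) /=; last by rewrite inE leqnn eqxx.
congr (_ + _); rewrite /block_pred; case: ifPn => [st_i|st'_i].
  apply: big1 => i' /andP[]; rewrite inE => /andP[le_i' /eqP b_i'].
  move/eqP=> []; apply: val_inj; apply/eqP; rewrite eqn_leq le_i' /=.
  exact: block_start_first bP st_i b_i'.
have [i_gt0 b_p] := not_block_start bP st'_i.
apply: eq_bigl => i'; rewrite !inE b_p ord_pred_val // andbAC.
congr (_ && _); by rewrite -[in RHS]ltnS prednK // ltn_neqAle andbC.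
Qed.

Lemma sum_block_lower_diff (V : zmodType) (h : 'I_n -> V) (i : 'I_n) :
  \sum_(i' in block_lower i) (h i' - block_pred h i') = h i.
Proof.
have [m] := ubnP (i : nat); elim: m i => // m IHm i lt_im.
rewrite sum_block_lower {2}/block_pred; case: ifPn => [st_i|st'_i].
  by rewrite /block_pred st_i subr0 addr0.
have [i_gt0 b_p] := not_block_start bP st'_i.
rewrite IHm; last by rewrite ord_pred_val //; lia.
by rewrite /block_pred (negPf st'_i) subrK.
Qed.

(** Distinct elements of [S] lie in distinct blocks, so their lower sets are disjoint. *)
Lemma sum_partial_transversal (V : nmodType) (h : 'I_n -> V) (S : {set 'I_n}) :
  (forall k, #|S :&: N k| <= 1)%N ->
  \sum_(i in S) \sum_(i' in block_lower i) h i' =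
  \sum_(i' in \bigcup_(i in S) block_lower i) h i'.
Proof.
move=> S_tr; pose F i := if i \in S then block_lower i else set0.
have -> : \bigcup_(i in S) block_lower i = \bigcup_i F i by rewrite big_mkcond.
rewrite partition_disjoint_bigcup => [|i j ne_ij]; last first.
  rewrite /F; case: ifP => iS; last by rewrite -setI_eq0 set0I.
  case: ifP => jS; last by rewrite -setI_eq0 setI0.
  apply/pred0P=> l /=; rewrite !inE; apply/negP.
  case/andP=> /andP[_ /eqP b_li] /andP[_ /eqP b_lj].
  move: ne_ij; apply/negP; rewrite negbK; apply/eqP.
  apply: (card_le1_eqP (S_tr (b l))).
    by rewrite inE jS bP b_lj eqxx.
  by rewrite inE iS bP b_li eqxx.
rewrite big_mkcond; apply: eq_bigr => i _; rewrite /F.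
by case: ifP => // _; rewrite big_set0.
Qed.

End BlockStructure.

(** * Closed form and recurrence for the lifting coefficients *)

Lemma mem_prefix_set (n : nat) (delta : {perm 'I_n}) (j i : 'I_n) :
  (i \in prefix_set delta j) = ((delta^-1)%g i <= j)%N.
Proof.
apply/imsetP/idP => [[l]|le_ij]; first by rewrite inE => le_lj ->; rewrite permK.
by exists ((delta^-1)%g i); rewrite ?inE ?permKV.
Qed.

Section Recurrence.
Variables (R : realType) (n t : nat) (f : R -> R) (a : 'I_n -> R).
Variables (N : 'I_t -> {set 'I_n}) (delta : {perm 'I_n}).
Hypothesis f_concave : concave f.
Hypothesis f0 : f 0 = 0.
Hypothesis a_ge0 : forall i, 0 <= a i.
Hypothesis N_part : consecutive_partition N.
Hypothesis a_asc : block_ascending N a.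
Hypothesis delta_asc : partial_ascending N delta.
Variable b : 'I_n -> 'I_t.
Hypothesis bP : forall i k, (i \in N k) = (b i == k).

Definition prefix_weight : nat -> R :=
  partial_sum (fun l => a (delta l) - block_pred N a (delta l)).

Let incr (i : 'I_n) : R :=
  f (prefix_weight ((delta^-1)%g i).+1) - f (prefix_weight ((delta^-1)%g i)).

(** Candidate closed form for the lifting coefficient, obtained by unrolling the recurrence along
    the block. *)
Let coef (i : 'I_n) : R := \sum_(i' in block_lower b i) incr i'.

(** The minimizer for [delta j]: within a block the largest element of the prefix is also the latest
    one lifted. *)
Let max_set (j : 'I_n) : {set 'I_n} :=
  [set i in prefix_set delta j |
    [forall i' in prefix_set delta j, (b i' == b i) ==> (i' <= i)%N]].

Lemma block_increment_ge0 (i : 'I_n) : 0 <= a i - block_pred N a i.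
Proof.
rewrite /block_pred; case: ifPn => [_|st'_i]; first by rewrite subr0.
have [i_gt0 b_p] := not_block_start N_part bP st'_i.
rewrite subr_ge0; apply: (a_asc (k := b i)); rewrite ?bP ?b_p //.
by rewrite ord_pred_val // leq_pred.
Qed.

Lemma inv_delta_mono (i i' : 'I_n) :
  b i = b i' -> (i <= i')%N -> ((delta^-1)%g i <= (delta^-1)%g i')%N.
Proof.
move=> b_ii' le_ii'; rewrite leqNgt; apply: contraL le_ii' => lt_i'i.
rewrite -ltnNge -[i](permKV delta) -[i'](permKV delta).
by apply: (delta_asc (k := b i) lt_i'i); rewrite permKV bP ?b_ii'.
Qed.

Lemma sum_coefE (S : {set 'I_n}) : (forall k, #|S :&: N k| <= 1)%N ->
  \sum_(i in S) coef i =
  \sum_(l | delta l \in \bigcup_(i in S) block_lower b i)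
     (f (prefix_weight l.+1) - f (prefix_weight l)).
Proof.
move=> S_tr; rewrite (sum_partial_transversal bP) // (reindex_inj (@perm_inj _ delta)).
by apply: eq_bigr => l _; rewrite /incr permK.
Qed.

Lemma sum_weightE (S : {set 'I_n}) : (forall k, #|S :&: N k| <= 1)%N ->
  \sum_(i in S) a i =
  \sum_(l | delta l \in \bigcup_(i in S) block_lower b i)
     (a (delta l) - block_pred N a (delta l)).
Proof.
move=> S_tr.
under [LHS]eq_bigr => i _ do rewrite -(sum_block_lower_diff N_part bP a i).
by rewrite (sum_partial_transversal bP) // (reindex_inj (@perm_inj _ delta)).
Qed.

(** Both sums run over the positions lying below [S] in their blocks: the left one over increments
    of [f], the right one over increments of [a]. Concavity then compares them. *)
Lemma sum_coef_le (S : {set 'I_n}) : (forall k, #|S :&: N k| <= 1)%N ->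
  \sum_(i in S) coef i <= f (\sum_(i in S) a i).
Proof.
move=> S_tr; rewrite sum_coefE // sum_weightE //.
by apply: sum_increments_le => // l; apply: block_increment_ge0.
Qed.

Lemma max_set_feasible (j : 'I_n) : feasible N delta j (max_set j).
Proof.
apply/and3P; split.
- by apply/subsetP=> i; rewrite inE => /andP[].
- apply/forallP=> k; apply/card_le1_eqP => i i'.
  rewrite !inE !bP => /andP[/andP[pi /'forall_implyP mi] /eqP bi].
  move=> /andP[/andP[pi' /'forall_implyP mi'] /eqP bi'].
  apply: val_inj; apply/eqP; rewrite eqn_leq.
  have := mi _ pi'; have := mi' _ pi; rewrite bi bi' eqxx /= => -> ->.
  by [].
(* An element above [delta j] in its block is lifted later, so [delta j] is the maximum of its block
   in the prefix. *)
- rewrite inE mem_prefix_set permK leqnn /=.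
  apply/'forall_implyP => i; rewrite mem_prefix_set => le_ij.
  apply/implyP => /eqP bi; rewrite leqNgt; apply/negP => lt_ji.
  have := inv_delta_mono (esym bi) (ltnW lt_ji); rewrite permK => le_ji.
  have /val_inj def_j : (delta^-1)%g i = j :> nat.
    by apply/eqP; rewrite eqn_leq le_ij.
  by move: lt_ji; rewrite -def_j permKV ltnn.
Qed.

(** A prefix is downward closed in each block because blocks are lifted in increasing order;
    conversely each of its elements lies below the maximum of its block. *)
Lemma max_set_lower (j : 'I_n) :
  \bigcup_(i in max_set j) block_lower b i = prefix_set delta j.
Proof.
apply/setP=> l; apply/bigcupP/idP => [[i]|pl].
  rewrite inE => /andP[pi _]; rewrite inE => /andP[le_li /eqP bl].
  move: pi; rewrite !mem_prefix_set; apply: leq_trans.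
  exact: inv_delta_mono.
pose P i := (i \in prefix_set delta j) && (b i == b l).
have Pl : P l by rewrite /P pl eqxx.
have [i /andP[pi /eqP bi] max_i] := arg_maxnP (fun i : 'I_n => i : nat) Pl.
exists i; last by rewrite inE bi eqxx andbT; apply: max_i.
rewrite inE pi /=; apply/'forall_implyP => i' pi'; apply/implyP => /eqP bi'.
by apply: max_i; rewrite /P pi' bi' bi eqxx.
Qed.

(** The positions below [max_set j] are exactly those up to [j], so no position is skipped and the
    increments of [f] telescope with equality. *)
Lemma sum_coef_max_set (j : 'I_n) :
  \sum_(i in max_set j) coef i = f (\sum_(i in max_set j) a i).
Proof.
have /and3P[_ /forallP tr _] := max_set_feasible j.
rewrite sum_coefE // sum_weightE // max_set_lower.
under eq_bigl do rewrite mem_prefix_set permK -ltnS.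
under [in RHS]eq_bigl do rewrite mem_prefix_set permK -ltnS.
exact: sum_increments.
Qed.

Lemma lift_coef_coef (j : 'I_n) : lift_coef f a N delta (delta j) = coef (delta j).
Proof.
have [m] := ubnP (j : nat); elim: m j => // m IHm j lt_jm.
(* By induction the objective is [coef (delta j)] plus the slack of [S] in [sum_coef_le]; this slack
   is nonnegative and vanishes at [max_set j]. *)
have objE S : feasible N delta j S -> objective f a delta (lift_coef f a N delta) j S
    = f (\sum_(i in S) a i) - \sum_(i in S) coef i + coef (delta j).
  case/and3P=> sSj _ jS.
  rewrite /objective [X in _ = _ - X + _](big_setD1 _ jS) /=.
  rewrite [X in _ - X = _](eq_bigr coef) => [|i]; first by ring.
  rewrite 2!inE => /andP[ne_ij iS].
  have := subsetP sSj i iS; rewrite mem_prefix_set leq_eqVlt.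
  case/orP=> [/eqP/val_inj def_j|lt_ij].
    by rewrite -def_j permKV eqxx in ne_ij.
  by rewrite -[i](permKV delta) IHm //; lia.
have [[S Sf ->] min_j] := lift_coef_min f a N delta j.
apply/eqP; rewrite eq_le; apply/andP; split; last first.
  rewrite objE // lerDr subr_ge0; apply: sum_coef_le.
  by case/and3P: Sf => _ /forallP.
have Mf := max_set_feasible j.
have := min_j _ Mf; rewrite (objE _ Mf) sum_coef_max_set subrr add0r.
by [].
Qed.

Lemma lift_coef_rec (j : 'I_n) :
  lift_coef f a N delta (delta j) =
  f (prefix_weight j.+1) - f (prefix_weight j) +
  block_pred N (lift_coef f a N delta) (delta j).
Proof.
rewrite lift_coef_coef /coef (sum_block_lower N_part bP) {1}/incr permK.
congr (_ + _); rewrite /block_pred; case: ifP => // _.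
by rewrite -[ord_pred _](permKV delta) lift_coef_coef.
Qed.

End Recurrence.

(** * Time-bounded reasoning about programs *)

Section Programs.
Variables (R : realType) (f : R -> R).

(** A total-correctness judgement with time budget [B], closed under the program constructors by the
    rules that follow. *)
Definition runs (c : cmd) (s : state R) (B : nat) (Q : state R -> Prop) : Prop :=
  exists T s', [/\ exec f c s T s', (T <= B)%N & Q s'].

Lemma runs_seq (c1 c2 : cmd) (s : state R) (B1 B2 : nat) (P Q : state R -> Prop) :
  runs c1 s B1 P -> (forall s', P s' -> runs c2 s' B2 Q) ->
  runs (Seq c1 c2) s (B1 + B2) Q.
Proof.
move=> [T1 [s1 [run1 leT1 Ps1]]] /(_ _ Ps1) [T2 [s2 [run2 leT2 Qs2]]].
by exists (T1 + T2)%N, s2; split=> //; [exact: ExecSeq run1 run2 | exact: leq_add].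
Qed.

Lemma runs_if (b : test) (c1 c2 : cmd) (s : state R) (B : nat)
    (Q : state R -> Prop) :
  runs (if teval f s b then c1 else c2) s B Q -> runs (If b c1 c2) s (tcost b + B) Q.
Proof.
move=> [T [s' [run leT Qs']]].
by exists (tcost b + T)%N, s'; split=> //; [exact: ExecIf run | rewrite leq_add2l].
Qed.

Lemma runs_iset (x : nat) (p e : iexp) (s : state R) (Q : state R -> Prop) :
  Q (State (update (imem s) x (ieval s p) (ieval s e)) (rmem s)) ->
  runs (ISet x p e) s (icost p + icost e).+1 Q.
Proof. by move=> Qs; do 2 eexists; split; [exact: ExecISet | |]. Qed.

Lemma runs_rset (x : nat) (p : iexp) (e : rexp) (s : state R)
    (Q : state R -> Prop) :
  Q (State (imem s) (update (rmem s) x (ieval s p) (reval f s e))) ->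
  runs (RSet x p e) s (icost p + rcost e).+1 Q.
Proof. by move=> Qs; do 2 eexists; split; [exact: ExecRSet | |]. Qed.

Lemma runs_iset_seq (x : nat) (p e : iexp) (c : cmd) (s : state R)
    (B : nat) (Q : state R -> Prop) :
  runs c (State (update (imem s) x (ieval s p) (ieval s e)) (rmem s)) B Q ->
  runs (Seq (ISet x p e) c) s ((icost p + icost e).+1 + B) Q.
Proof.
move=> run_c; apply: (runs_seq (P := fun s' =>
  s' = State (update (imem s) x (ieval s p) (ieval s e)) (rmem s))).
  exact: runs_iset.
by move=> _ ->.
Qed.

Lemma runs_rset_seq (x : nat) (p : iexp) (e : rexp)
    (c : cmd) (s : state R) (B : nat) (Q : state R -> Prop) :
  runs c (State (imem s) (update (rmem s) x (ieval s p) (reval f s e))) B Q ->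
  runs (Seq (RSet x p e) c) s ((icost p + rcost e).+1 + B) Q.
Proof.
move=> run_c; apply: (runs_seq (P := fun s' =>
  s' = State (imem s) (update (rmem s) x (ieval s p) (reval f s e)))).
  exact: runs_rset.
by move=> _ ->.
Qed.

Lemma runs_leq (c : cmd) (s : state R) (B B' : nat) (Q : state R -> Prop) :
  runs c s B Q -> (B <= B')%N -> runs c s B' Q.
Proof.
move=> [T [s' [run leT Qs']]] le_BB'; exists T, s'; split=> //.
exact: leq_trans le_BB'.
Qed.

(* Index cell (4, 0) is the loop counter. *)
Definition counter : iexp := IGet 4 (IConst 0).

Definition for_loop (bound : iexp) (body : cmd) : cmd :=
  Seq (ISet 4 (IConst 0) (IConst 0))
    (While (ILe (IAdd counter (IConst 1)) bound)
       (Seq body (ISet 4 (IConst 0) (IAdd counter (IConst 1))))).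

Definition set_counter (v : nat) (s : state R) : state R :=
  State (update (imem s) 4 0 v) (rmem s).

(** [P l] is the invariant after [l] rounds; it must fix the value of [bound] and survive changes of
    the counter. A round costs [icost bound + 5] for the test, [K] for the body and 6 for the
    increment. *)
Lemma runs_for (bound : iexp) (body : cmd) (K m : nat)
    (P : nat -> state R -> Prop) (s : state R) :
  (forall l s', P l s' -> ieval s' bound = m) ->
  (forall l v s', P l s' -> P l (set_counter v s')) ->
  (forall l s', (l < m)%N -> P l s' -> imem s' 4 0 = l ->
     runs body s' K (fun s'' => P l.+1 s'' /\ imem s'' 4 0 = l)) ->
  P 0%N s ->
  runs (for_loop bound body) s (m.+1 * (icost bound + K + 11)) (P m).
Proof.
move=> P_bound P_counter P_step P0.
(* The extra round in the budget pays for the failing test, and the 3 units set aside from it pay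
   for the initialization of the counter. *)
suff loop l s' : (l <= m)%N -> P l s' -> imem s' 4 0 = l ->
    runs (While (ILe (IAdd counter (IConst 1)) bound)
            (Seq body (ISet 4 (IConst 0) (IAdd counter (IConst 1)))))
      s' ((m - l).+1 * (icost bound + K + 11) - 3) (P m).
  apply: runs_leq; first apply: (runs_seq
    (P := fun s' => P 0%N s' /\ imem s' 4 0 = 0%N)).
  - by apply: runs_iset; split; first exact: P_counter.
  - by move=> s' [Ps' cnt]; apply: (loop 0%N).
  - by rewrite /= subn0; lia.
move=> le_lm; have [d def_d] : exists d, d = (m - l)%N by exists (m - l)%N.
rewrite -def_d; elim: d => [|d IHd] in l le_lm def_d s' *.
  move=> Ps' cnt; have def_l : l = m by lia.
  do 2 eexists; split; first apply: ExecWhileDone.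
  - by rewrite /= cnt (P_bound _ _ Ps'); lia.
  - by rewrite /=; lia.
  - by rewrite -def_l.
move=> Ps' cnt; have lt_lm : (l < m)%N by lia.
have [T1 [s1 [run1 leT1 [Ps1 cnt1]]]] :
    runs (Seq body (ISet 4 (IConst 0) (IAdd counter (IConst 1)))) s' (K + 6)
      (fun s2 => P l.+1 s2 /\ imem s2 4 0 = l.+1).
  apply: (runs_seq (P_step _ _ lt_lm Ps' cnt)) => s1 [Ps1 cnt1].
  apply: runs_iset; split; first exact: P_counter.
  by rewrite /= /update cnt1 addn1.
have def_d' : d = (m - l.+1)%N by lia.
have [T2 [s2 [run2 leT2 Ps2]]] := IHd l.+1 lt_lm def_d' s1 Ps1 cnt1.
do 2 eexists; split; first apply: (ExecWhileStep _ run1 run2).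
- by rewrite /= cnt (P_bound _ _ Ps'); lia.
- by move: leT1 leT2 => /=; rewrite !mulSn; lia.
- by [].
Qed.

End Programs.

(** * The linear-time algorithm, its correctness and its cost *)

Section Algorithm.

Let num_elements : iexp := IGet 0 (IConst 0).
Let num_blocks : iexp := IGet 0 (IConst 1).
(* Index cell (5, 0) holds the start of the current block while the blocks are
   scanned, and the current element afterwards. *)
Let current : iexp := IGet 5 (IConst 0).
Let previous : iexp := ISub current (IConst 1).
Let total : rexp := RGet 2 (IConst 0).
Let new_total : rexp := RGet 2 (IConst 1).

(* Index array 3 flags the first elements of the blocks. *)
Definition clear_flags : cmd := for_loop num_elements (ISet 3 counter (IConst 0)).

Definition mark_block : cmd :=
  Seq (ISet 3 current (IConst 1))
    (ISet 5 (IConst 0) (IAdd current (IGet 1 counter))).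

Definition mark_blocks : cmd :=
  Seq (ISet 5 (IConst 0) (IConst 0)) (for_loop num_blocks mark_block).

(** Real cells (2, 0) and (2, 1) hold the prefix weights before and after the current element; both
    are needed at once for the increment of [f]. The flag decides whether the predecessor's weight
    and coefficient enter. *)
Definition lift_element : cmd :=
  Seq (ISet 5 (IConst 0) (IGet 2 counter))
    (If (ILe (IConst 1) (IGet 3 current))
       (Seq (RSet 2 (IConst 1) (RAdd total (RGet 0 current)))
       (Seq (RSet 1 current (RSub (REval new_total) (REval total)))
          (RSet 2 (IConst 0) new_total)))
       (Seq (RSet 2 (IConst 1)
               (RAdd total (RSub (RGet 0 current) (RGet 0 previous))))
       (Seq (RSet 1 current
               (RAdd (RSub (REval new_total) (REval total)) (RGet 1 previous)))
          (RSet 2 (IConst 0) new_total)))).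

Definition lift_elements : cmd :=
  Seq (RSet 2 (IConst 0) (RConst 0)) (for_loop num_elements lift_element).

Definition lifting_algorithm : cmd :=
  Seq clear_flags (Seq mark_blocks lift_elements).

Variables (R : realType) (n t : nat) (f : R -> R) (a : 'I_n -> R).
Variables (N : 'I_t -> {set 'I_n}) (delta : {perm 'I_n}).

(** Clearing is necessary since the memory outside the input is arbitrary. Each round costs 17: 2
    for reading the bound, 4 for the body and 11 for the loop overhead. *)
Lemma runs_clear_flags (s : state R) : encodes_input a N delta s ->
  runs f clear_flags s (n.+1 * 17) (fun s' =>
    encodes_input a N delta s' /\ forall i, (i < n)%N -> imem s' 3 i = 0%N).
Proof.
move=> inp; apply: (runs_for (K := 4) (P := fun m s' =>
  encodes_input a N delta s' /\ forall i, (i < m)%N -> imem s' 3 i = 0%N)).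
- by move=> l s' [[[]]].
- by [].
- move=> l s' lt_ln [inp' fl] cnt.
  apply: runs_iset; split=> //; split=> // i.
  rewrite /= /update cnt ltnS leq_eqVlt /=.
  by case: eqP => //= _; apply: fl.
- by [].
Qed.

Definition flags_up_to (m : nat) (s : state R) : Prop :=
  forall i, (i < n)%N ->
    imem s 3 i = [exists k : 'I_t, (k < m)%N && (i == block_start N k)] :> nat.

Lemma runs_mark_blocks (s : state R) :
  encodes_input a N delta s -> (forall i, (i < n)%N -> imem s 3 i = 0%N) ->
  runs f mark_blocks s (3 + t.+1 * 25) (fun s' =>
    encodes_input a N delta s' /\ flags_up_to t s').
Proof.
move=> inp fl0; apply: runs_iset_seq.
have run : runs f (for_loop num_blocks mark_block)
    (State (update (imem s) 5 0 0) (rmem s)) (t.+1 * 25)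
    (fun s' => [/\ encodes_input a N delta s', imem s' 5 0 = block_start N t
      & flags_up_to t s']).
  (* The invariant also tracks the running sum of block sizes in index cell (5, 0), which is the
     next position to flag. *)
  apply: (runs_for (K := 12) (P := fun m s' =>
    [/\ encodes_input a N delta s', imem s' 5 0 = block_start N m
      & flags_up_to m s'])).
  - by move=> l s' [[[]]].
  - by [].
  - move=> m s' lt_mt [inp' cur fl] cnt.
    apply: runs_iset_seq; apply: runs_iset; split=> //; split=> //=.
      have [_ sz _ _] := inp'.
      rewrite /update /= cnt cur (sz (Ordinal lt_mt)).
      by rewrite -(block_startS _ (Ordinal lt_mt)).
    move=> i lt_in; rewrite /= /update /= cur fl //.
    case: eqP => [->|/eqP ne_i].
      suff -> : [exists k : 'I_t, (k < m.+1)%N && (block_start N m == block_start N k)]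
        by [].
      by apply/existsP; exists (Ordinal lt_mt); rewrite /= ltnSn eqxx.
    congr (nat_of_bool _); apply: eq_existsb => k; rewrite ltnS [in RHS]leq_eqVlt.
    by have [->|_] := eqVneq (k : nat) m; rewrite ?(negPf ne_i) ?andbF.
  - split=> //; first by rewrite block_start0.
    by move=> i lt_in; rewrite /= /update /= fl0 //; case: existsP => // -[].
have [T [s' [run' leT [inp' _ fl']]]] := run.
by exists T, s'.
Qed.

Hypothesis f_concave : concave f.
Hypothesis f0 : f 0 = 0.
Hypothesis a_ge0 : forall i, 0 <= a i.
Hypothesis N_part : consecutive_partition N.
Hypothesis a_asc : block_ascending N a.
Hypothesis delta_asc : partial_ascending N delta.

Let flagged (s : state R) : Prop :=
  forall i, (i < n)%N -> imem s 3 i = is_block_start N i :> nat.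

Let lifted (m : nat) (s : state R) : Prop :=
  [/\ encodes_input a N delta s, flagged s,
      rmem s 2 0 = prefix_weight a N delta m
    & forall l : 'I_n, (l < m)%N -> rmem s 1 (delta l) = lift_coef f a N delta (delta l)].

Lemma runs_lift_element (m : nat) (s : state R) : (m < n)%N ->
  lifted m s -> imem s 4 0 = m ->
  runs f lift_element s 100 (fun s' => lifted m.+1 s' /\ imem s' 4 0 = m).
Proof.
move=> lt_mn [inp fl tot out] cnt; have [_ _ pm am] := inp.
pose j := Ordinal lt_mn; have [b bP] := block_index N_part.
have perm_j : imem s 2 m = delta j by rewrite (pm j).
have coef_j := lift_coef_rec f_concave f0 a_ge0 N_part a_asc delta_asc bP j.
have tot_j : prefix_weight a N delta m.+1 =
  prefix_weight a N delta m + (a (delta j) - block_pred N a (delta j)).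
  exact: (partial_sumS _ j).
(* Storing at [delta j] keeps the earlier coefficients, by injectivity of [delta]. *)
have lifted_j v : v = lift_coef f a N delta (delta j) ->
    forall l : 'I_n, (l < m.+1)%N ->
    (if delta l == delta j :> nat then v else rmem s 1 (delta l)) =
    lift_coef f a N delta (delta l).
  move=> -> l; rewrite ltnS leq_eqVlt (inj_eq val_inj) (inj_eq perm_inj) => le_lm.
  have [->//|ne_lj] := eqVneq l j; apply: out.
  by case/orP: le_lm => // /eqP eq_lm; case/eqP: ne_lj; apply: val_inj.
apply: runs_leq; first apply: runs_iset_seq.
  apply: runs_if; rewrite /= /update /= cnt perm_j fl //.
  have [st_j|st'_j] := boolP (is_block_start N (delta j)); rewrite /=.
    apply: (runs_leq (B' := 40)); first do 2 apply: runs_rset_seq.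
      apply: runs_rset; split=> //; split=> //; rewrite /= /update /=.
        by rewrite tot am tot_j /block_pred st_j subr0.
      apply: lifted_j.
      by rewrite coef_j tot_j tot am /block_pred st_j subr0 addr0.
    by [].
  have [j_gt0 b_p] := not_block_start N_part bP st'_j.
  have val_p : (delta j - 1)%N = ord_pred (delta j) by rewrite ord_pred_val ?subn1.
  (* The block predecessor precedes [delta j] in the permutation, so its coefficient is already
     stored. *)
  have out_p : rmem s 1 (ord_pred (delta j)) =
      lift_coef f a N delta (ord_pred (delta j)).
    rewrite -[ord_pred _](permKV delta); apply: out.
    have le_p : (ord_pred (delta j) <= delta j)%N by rewrite ord_pred_val ?leq_pred.
    have := inv_delta_mono delta_asc bP b_p le_p; rewrite permK leq_eqVlt.
    case/orP=> // /eqP/val_inj/(congr1 delta); rewrite permKV => eq_p.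
    by move: val_p; rewrite eq_p; lia.
  apply: (runs_leq (B' := 40)); first do 2 apply: runs_rset_seq.
    apply: runs_rset; split=> //; split=> //; rewrite /= /update /=.
      by rewrite tot val_p !am tot_j /block_pred (negPf st'_j).
    apply: lifted_j.
    by rewrite coef_j tot_j tot val_p !am out_p /block_pred (negPf st'_j).
  by [].
by [].
Qed.

Lemma runs_lift_elements (s : state R) : encodes_input a N delta s -> flagged s ->
  runs f lift_elements s (3 + n.+1 * 113) (lifted n).
Proof.
move=> inp fl; apply: runs_rset_seq.
apply: (runs_for (K := 100) (P := lifted)).
- by move=> l s' [[[]]].
- by [].
- by move=> m s' lt_mn lift_m cnt; apply: runs_lift_element.
- by split; rewrite // [RHS]partial_sum0.
Qed.

Lemma runs_lifting_algorithm (s : state R) : encodes_input a N delta s ->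
  runs f lifting_algorithm s (n.+1 * 17 + (3 + t.+1 * 25 + (3 + n.+1 * 113)))
    (encodes_output (lift_coef f a N delta)).
Proof.
move=> inp; apply: (runs_seq (runs_clear_flags inp)) => s1 [inp1 fl1].
apply: (runs_seq (runs_mark_blocks inp1 fl1)) => s2 [inp2 fl2].
have fl2' : flagged s2.
  move=> i /fl2 ->; congr (nat_of_bool _).
  by apply: eq_existsb => k; rewrite ltn_ord.
have [T [s' [run leT [_ _ _ out]]]] := runs_lift_elements inp2 fl2'.
exists T, s'; split=> // i.
by rewrite -[i](permKV delta); apply: out.
Qed.

End Algorithm.

Theorem theorem4p14 (R : realType) :
  exists (algorithm : cmd) (C : nat),
    forall (n t : nat) (f : R -> R) (a : 'I_n -> R)
           (N : 'I_t -> {set 'I_n}) (delta : {perm 'I_n}) (s : state R),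
      (0 < n)%N -> (0 < t)%N ->
      concave f -> f 0 = 0 ->
      (forall i : 'I_n, 0 <= a i) ->
      consecutive_partition N ->
      block_ascending N a ->
      partial_ascending N delta ->
      encodes_input a N delta s ->
      exists (T : nat) (s' : state R),
        [/\ exec f algorithm s T s',
            (T <= C * n)%N
          & encodes_output (lift_coef f a N delta) s'].
Proof.
(* The cost is at most [130 (n + 1) + 25 (t + 1) + 6], which is at most [316 n] because [t <= n] and
   [1 <= n]. *)
exists lifting_algorithm, 320%N.
move=> n t f a N delta s n_gt0 t_gt0 f_cv f0 a_ge0 N_part a_asc d_asc inp.
have le_tn := num_blocks_leq N_part.
have [T [s' [run leT out]]] :=
  runs_lifting_algorithm f_cv f0 a_ge0 N_part a_asc d_asc inp.
exists T, s'; split=> //; lia.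
Qed.
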